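(* (i) The generalised left Fischer cover of a sofic shift $X$ is a left-resolving and predecessor-separated presentation of $X$. (ii) If $X$ is an irreducible sofic shift, then the generalised left Fischer cover of $X$ is isomorphic (as a labelled graph) to the left Fischer cover of $X$. (iii) If $X_1,X_2$ are sofic shifts with disjoint alphabets, then the generalised left Fischer cover of $X_1\cup X_2$ is the disjoint union of the generalised left Fischer covers of $X_1$ and $X_2$.
   Context: A shift space over a finite alphabet $\mathcal{A}$ is a closed shift-invariant subset $X\subseteq\mathcal{A}^{\mathbb{Z}}$. It is irreducible if for all words $u,w$ in its language $\mathcal{B}(X)$ (the set of finite factors of elements of $X$) there is $v$ with $uvw\in\mathcal{B}(X)$. $X^-$ and $X^+$ are the sets of left-rays $\cdots x_{-2}x_{-1}$ and right-rays $x_0x_1\cdots$ of elements of $X$, and $P_\infty(x^+)=\{y^-\in X^-\mid y^-x^+\in X\}$. A labelled graph $(E,\mathcal{L})$ is a directed graph $E=(E^0,E^1,r,s)$ with a labelling of the edges; it presents the shift space of label sequences of biinfinite paths. A shift space is sofic if it is presented by a finite labelled graph. A presentation is left-resolving if no vertex receives two edges with the same label. The predecessor set of a vertex $v$ in a presentation of $X$ is the set of left-rays in $X$ that are labels of left-infinite paths terminating at $v$; the presentation is predecessor-separated if distinct vertices have distinct predecessor sets. The left Fischer cover of an irreducible sofic shift is its (unique up to isomorphism) left-resolving presentation with the minimal number of vertices. Left Krieger cover of a sofic shift $X$: the labelled graph $(K,\mathcal{L}_K)$ with $K^0=\{P_\infty(x^+)\mid x^+\in X^+\}$ and an edge labelled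 $a$ from $P$ to $P'$ iff there is $x^+\in X^+$ with $P=P_\infty(ax^+)$ and $P'=P_\infty(x^+)$. $P\in K^0$ is indecomposable if $V\subseteq K^0$ and $P=\bigcup_{Q\in V}Q$ imply $P\in V$. Write $P\ge P'$ if there is a (possibly trivial) path in $K$ from $P$ to $P'$. The generalised left Fischer cover of $X$ is the labelled subgraph of $(K,\mathcal{L}_K)$ induced by $\{P\in K^0\mid P\ge P'\text{ for some indecomposable }P'\in K^0\}$. *)

(* Defs.v *)
From mathcomp Require Import all_boot all_order all_algebra.
From mathcomp Require Import boolp classical_sets functions cardinality.
From mathcomp Require Import topology.
From Stdlib Require Import Relation_Operators.

Set Implicit Arguments.
Unset Strict Implicit.
Unset Printing Implicit Defensive.

Import GRing.Theory.
Local Open Scope classical_set_scope.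
Local Open Scope ring_scope.

(* Right-rays x_0 x_1 x_2 ... and left-rays ... x_(-2) x_(-1) are both encoded
   as functions on nat. A left-ray is read from right to left: its n-th value is
   the letter at position Negz n = - (n + 1). *)
Section Shifts.
Variable A : finType.
Implicit Types (X : set (int -> A)) (x y : nat -> A).

Definition shift (z : int -> A) : int -> A := fun i => z (i + 1).

Definition left_ray (z : int -> A) : nat -> A := fun n => z (Negz n).
Definition right_ray (z : int -> A) : nat -> A := fun n => z (Posz n).

Definition ray_cat y x : int -> A :=
  fun i => match i with Posz n => x n | Negz n => y n end.

Definition ray_cons (a : A) x : nat -> A :=
  fun n => if n is m.+1 then x m else a.

Definition shift_space X : Prop :=
  closed (X : set {ptws int -> discrete_topology A}) /\
  (forall z, X (shift z) <-> X z).

Definition language X : set (seq A) :=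
  [set w | exists (z : int -> A) (i : int),
     X z /\ w = mkseq (fun k => z (i + k%:Z)) (size w)].

Definition irreducible_shift X : Prop :=
  forall u w, language X u -> language X w ->
    exists v, language X (u ++ v ++ w).

Definition left_rays X : set (nat -> A) := left_ray @` X.
Definition right_rays X : set (nat -> A) := right_ray @` X.

Definition P_infty X x : set (nat -> A) :=
  [set y | left_rays X y /\ X (ray_cat y x)].

End Shifts.

Record lgraph (A : Type) := LGraph {
  vert : Type;
  edge : Type;
  src : edge -> vert;
  rng : edge -> vert;
  lab : edge -> A }.

Section LabelledGraphs.
Variable A : finType.
Implicit Types (G H : lgraph A) (X : set (int -> A)).

Definition finite_lgraph G : Prop :=
  finite_set [set: vert G] /\ finite_set [set: edge G].

Definition biinfinite_path G (e : int -> edge G) : Prop :=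
  forall i, rng (e i) = src (e (i + 1)).

Definition presents G X : Prop :=
  X = [set z | exists e : int -> edge G,
         biinfinite_path e /\ forall i, z i = lab (e i)].

Definition sofic X : Prop :=
  shift_space X /\ exists G, finite_lgraph G /\ presents G X.

(* As for left-rays, e 0 is the last edge of the path. *)
Definition left_infinite_path_to G (v : vert G) (e : nat -> edge G) : Prop :=
  rng (e 0%N) = v /\ forall n, rng (e n.+1) = src (e n).

Definition predecessor_set X G (v : vert G) : set (nat -> A) :=
  [set y | left_rays X y /\
     exists e : nat -> edge G,
       left_infinite_path_to v e /\ forall n, y n = lab (e n)].

Definition left_resolving G : Prop :=
  forall e f : edge G, rng e = rng f -> lab e = lab f -> e = f.

Definition predecessor_separated X G : Prop :=
  forall v w : vert G, predecessor_set X v = predecessor_set X w -> v = w.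

Definition reaches G : vert G -> vert G -> Prop :=
  clos_refl_trans (vert G) (fun v w => exists e, src e = v /\ rng e = w).

Definition induced_subgraph G (S : set (vert G)) : lgraph A :=
  @LGraph A {v : vert G | S v} {e : edge G | S (src e) /\ S (rng e)}
    (fun e => exist S (src (sval e)) (proj1 (svalP e)))
    (fun e => exist S (rng (sval e)) (proj2 (svalP e)))
    (fun e => lab (sval e)).

Definition disjoint_union G H : lgraph A :=
  @LGraph A (vert G + vert H) (edge G + edge H)
    (fun e => match e with inl e => inl (src e) | inr e => inr (src e) end)
    (fun e => match e with inl e => inl (rng e) | inr e => inr (rng e) end)
    (fun e => match e with inl e => lab e | inr e => lab e end).

Definition is_isomorphism G H (f : vert G -> vert H) (g : edge G -> edge H)
    : Prop :=
  [/\ bijective f, bijective g,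
      forall e, src (g e) = f (src e),
      forall e, rng (g e) = f (rng e)
    & forall e, lab (g e) = lab e].

Definition isomorphic G H : Prop :=
  exists (f : vert G -> vert H) (g : edge G -> edge H), is_isomorphism f g.

Definition is_left_fischer_cover X G : Prop :=
  [/\ left_resolving G, presents G X
    & forall H, left_resolving H -> presents H X ->
        ([set: vert G] #<= [set: vert H])%card].

End LabelledGraphs.

Section KriegerCover.
Variables (A : finType) (X : set (int -> A)).

Definition krieger_vertex : Type :=
  {P : set (nat -> A) | exists x, right_rays X x /\ P = P_infty X x}.

Definition krieger_edge : Type :=
  {t : krieger_vertex * A * krieger_vertex |
    exists x, [/\ right_rays X x, sval t.1.1 = P_infty X (ray_cons t.1.2 x)
                & sval t.2 = P_infty X x]}.

Definition left_krieger_cover : lgraph A :=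
  @LGraph A krieger_vertex krieger_edge
    (fun e => (sval e).1.1) (fun e => (sval e).2) (fun e => (sval e).1.2).

Definition indecomposable (P : krieger_vertex) : Prop :=
  forall V : set krieger_vertex, sval P = \bigcup_(Q in V) sval Q -> V P.

Definition generalised_left_fischer_cover : lgraph A :=
  @induced_subgraph A left_krieger_cover
    [set P | exists P' : krieger_vertex,
       indecomposable P' /\ @reaches A left_krieger_cover P P'].

Definition glfc_rays (v : vert generalised_left_fischer_cover)
    : set (nat -> A) := sval (sval v).

End KriegerCover.

(* Main.v *)
(* Write res_a P for the set of left-rays y with ya in P. Then P_infty(ax) =
   res_a P_infty(x), so the Krieger cover has an edge labelled a from P to Q
   exactly when P = res_a Q.

   (i) There are finitely many predecessor sets. One that is minimal among those
   containing a given left-ray is indecomposable, so every left-ray of X ends in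
   the cover, and compactness yields biinfinite paths.

   (ii) The map x |-> P_infty(x) is upper semicontinuous with finitely many
   values, hence locally constant at every x whose predecessor set is minimal.
   If X is irreducible, such "synchronizing" x can be reached from any word, so
   every predecessor set is a union of predecessor sets of synchronizing rays,
   and all vertices of the cover are of this kind. In a finite left-resolving
   presentation H, take x synchronizing such that the number of vertices where x
   starts is least: prepending letters cannot lose any of these vertices, so
   each of them has predecessor set P_infty(x). Irreducibility transports such
   an x to every vertex of the cover, which therefore embeds into H.

   (iii) A predecessor set of the union consists of rays over one of the two
   alphabets, so decompositions and edges do not mix the two shifts. *)

Require Import Defs.
From mathcomp Require Import all_boot all_order all_algebra.
From mathcomp Require Import boolp classical_sets functions cardinality.
From mathcomp Require Import topology.
From mathcomp Require Import zify.
From Stdlib Require Import Relation_Operators.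

Set Implicit Arguments.
Unset Strict Implicit.
Unset Printing Implicit Defensive.

Import GRing.Theory.
Local Open Scope classical_set_scope.
Local Open Scope ring_scope.

(** * Injections, finiteness and ultrafilters *)

Lemma inj_surj_bijective (T U : Type) (f : T -> U) :
  injective f -> (forall u, exists t, f t = u) -> bijective f.
Proof.
move=> injf /choice[g fg]; exists g => // t.
by apply: injf; rewrite fg.
Qed.

Lemma sval_inj (T : Type) (S : T -> Prop) : injective (@sval T S).
Proof.
move=> [u Su] [v Sv] /= uv; move: Su Sv; rewrite uv => Su Sv.
by congr exist; exact: Prop_irrelevance.
Qed.

Lemma finite_setT_inj (V : Type) : finite_set [set: V] ->
  exists (I : finType) (h : V -> I), injective h.
Proof.
move=> [n /card_set_bijP[h [hn hinj _]]].
exists 'I_n, (fun v => Ordinal (hn v I)) => v w /(congr1 val) /= vw.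
by apply: hinj; rewrite ?inE.
Qed.

Lemma inj_fin_card_le_infinite (V W : Type) (I : finType) (h : V -> I) :
  injective h -> ~ finite_set [set: W] -> ([set: V] #<= [set: W])%card.
Proof.
move=> hinj /infiniteP; apply: card_le_trans; apply/pcard_injP.
exists (fun v => enum_rank (h v) : nat) => v w _ _ /ord_inj/enum_rank_inj.
exact: hinj.
Qed.

Lemma inj_card_leT (V W : Type) (f : V -> W) :
  injective f -> ([set: V] #<= [set: W])%card.
Proof.
move=> finj.
have : $| {injfun [set: V] >-> [set: W]} |.
  by apply/injfunPex; exists f => // v w _ _; exact: finj.
by case=> g; exact: (inj_card_le g).
Qed.

Lemma card_leT_inj (V W : Type) :
  ([set: V] #<= [set: W])%card -> exists f : V -> W, injective f.
Proof.
move=> /card_leP/injfunPex[f _ finj].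
exists (fun v => val (f (to_setT v))) => v w /val_inj fvw.
by have /(congr1 val) := finj _ _ (in_setT _) (in_setT _) fvw.
Qed.

(** If [v] is missed, its iterates under [f] are pairwise distinct, too many to fit into [I]. *)
Lemma injective_self_map_surjective (V : Type) (I : finType) (h : V -> I) (f : V -> V) :
  injective h -> injective f -> forall v, exists w, f w = v.
Proof.
move=> hinj finj v; apply: contrapT => nv.
have it_inj i j : iter i f v = iter j f v -> i = j.
  elim: i j => [|i IH] [|j] //=.
  - by move=> /esym e; case: nv; exists (iter j f v).
  - by move=> e; case: nv; exists (iter i f v).
  - by move/finj/IH ->.
have /leq_card : injective (fun i : 'I_#|I|.+1 => h (iter i f v)).
  by move=> i j /hinj/it_inj/val_inj.
by rewrite card_ord ltnn.
Qed.

(** Otherwise the complements of the finitely many fibres all lie in [U], and so does their empty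
    intersection. *)
Lemma ultra_fin_eq (T : Type) (U : set_system T) (V : Type) (I : finType)
    (h : V -> I) (f : T -> V) : UltraFilter U -> injective h ->
  exists v, U [set t | f t = v].
Proof.
move=> UU hinj; apply: contrapT => nv.
have : U [set t | forall i, h (f t) <> i].
  apply: filter_forall => i.
  have [Ui|//] := in_ultra_setVsetC [set t | h (f t) = i] UU.
  have [t hti] := filter_ex Ui.
  case: nv; exists (f t); apply: filterS Ui => s /= hsi.
  by apply: hinj; rewrite hsi hti.
by move=> /filter_ex[t /(_ (h (f t)))].
Qed.

(** * Rays, prefixes and shifts *)

Section Rays.
Variable A : finType.
Implicit Types (x y : nat -> A) (z : int -> A) (a : A).

Definition shift_by (k : int) z : int -> A := fun i => z (i + k).

Definition agree (n : nat) x x' := forall i, (i < n)%N -> x i = x' i.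

(** Left-rays are read from right to left, so [ray_cons a y] is the left-ray ya. *)
Definition residual a (P : set (nat -> A)) : set (nat -> A) :=
  [set y | P (ray_cons a y)].

Definition tail x : nat -> A := fun n => x n.+1.

Lemma ray_consK x : ray_cons (x 0%N) (tail x) = x.
Proof. by apply: funext => -[]. Qed.

Lemma agree_ray_cons a n x x' : agree n x x' ->
  agree n.+1 (ray_cons a x) (ray_cons a x').
Proof. by move=> e [|i] //=; exact: e. Qed.

Lemma agreeS n x x' : agree n.+1 x x' ->
  x 0%N = x' 0%N /\ agree n (tail x) (tail x').
Proof. by move=> e; split=> [|i ilt]; exact: e. Qed.

Lemma agree_le m n x x' : (m <= n)%N -> agree n x x' -> agree m x x'.
Proof. by move=> mn e i im; apply: e; exact: leq_trans mn. Qed.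

Lemma ray_cat_rays z : ray_cat (left_ray z) (right_ray z) = z.
Proof. by apply: funext => -[]. Qed.

Lemma shift_ray_cat a y x :
  shift (ray_cat y (ray_cons a x)) = ray_cat (ray_cons a y) x.
Proof.
apply: funext => -[n|[|n]] //; rewrite /shift.
- by rewrite -PoszD addn1.
- have -> : Negz n.+1 + 1 = Negz n by lia.
  by [].
Qed.

Lemma shift_byD k l z : shift_by k (shift_by l z) = shift_by (k + l) z.
Proof. by apply: funext => i; rewrite /shift_by addrA. Qed.

Lemma shift_by0 z : shift_by 0 z = z.
Proof. by apply: funext => i; rewrite /shift_by addr0. Qed.

Lemma right_ray_shift z : right_ray z = ray_cons (z 0) (right_ray (shift z)).
Proof.
apply: funext => -[|n] //; rewrite /right_ray /shift /=.
by rewrite -PoszD addn1.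
Qed.

End Rays.

(** * Shift-invariance and closedness of a shift space *)

Section ShiftSpace.
Variables (A : finType) (X : set (int -> A)).
Hypothesis HX : shift_space X.
Implicit Types (x y : nat -> A) (z : int -> A) (a : A).

Lemma shift_by_mem k z : X (shift_by k z) <-> X z.
Proof.
have posk (n : nat) w : X (shift_by n%:Z w) <-> X w.
  elim: n w => [|n IH] w; first by rewrite shift_by0.
  have -> : shift_by n.+1%:Z w = shift (shift_by n%:Z w).
    by apply: funext => i; rewrite /shift /shift_by; congr w; lia.
  by rewrite HX.2.
case: k => n; first exact: posk.
rewrite -(posk n.+1 (shift_by _ z)) shift_byD NegzE subrr.
by rewrite shift_by0.
Qed.

(** Agreement on growing windows is pointwise convergence to [z], and [X] is closed. *)
Lemma approx_mem z :
  (forall n : nat, exists z', X z' /\ forall i : int, (`|i| <= n)%N -> z' i = z i) ->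
  X z.
Proof.
move=> /choice[u uP].
pose D := discrete_topology A.
have uz : (u n : {ptws discrete_topology int -> D}) @[n --> \oo] -->
    (z : {ptws discrete_topology int -> D}).
  apply/(@pointwise_cvgP (discrete_topology int) D) => i.
  apply: cvg_near_cst; exists `|i : int|%N => // n /= ni.
  by have [_ ->] := uP n.
apply: (@closed_cvg _ {ptws int -> discrete_topology A} _ _ u X HX.1 _ z uz).
by near=> n; have [] := uP n.
Unshelve. all: by end_near.
Qed.

End ShiftSpace.

(** * Predecessor sets of right-rays *)

Section Predecessors.
Variables (A : finType) (X : set (int -> A)).
Hypothesis HX : shift_space X.
Implicit Types (x y : nat -> A) (z : int -> A) (a : A).

Lemma P_inftyE x : P_infty X x = [set y | X (ray_cat y x)].
Proof.
by apply/seteqP; split=> [y []//|y Xyx]; split=> //; exists (ray_cat y x).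
Qed.

Lemma P_infty_cons a x : P_infty X (ray_cons a x) = residual a (P_infty X x).
Proof.
rewrite !P_inftyE; apply/seteqP.
by split=> y; rewrite /residual /= -shift_ray_cat HX.2.
Qed.

Lemma right_rays_ray x : right_rays X x <-> P_infty X x !=set0.
Proof.
rewrite P_inftyE; split=> [[z Xz <-]|[y Xyx]]; last by exists (ray_cat y x).
by exists (left_ray z) => /=; rewrite ray_cat_rays.
Qed.

Lemma P_infty_left_ray z : X z -> P_infty X (right_ray z) (left_ray z).
Proof. by move=> Xz; rewrite P_inftyE /= ray_cat_rays. Qed.

Lemma P_infty_right_ray_nonempty z : X z -> P_infty X (right_ray z) !=set0.
Proof. by move=> Xz; exists (left_ray z); exact: P_infty_left_ray. Qed.

Lemma ray_cat_closed x y :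
  (forall n, exists y' x', [/\ agree n y' y, agree n x' x & X (ray_cat y' x')]) ->
  X (ray_cat y x).
Proof.
move=> yx; apply: approx_mem => // n.
(* The window from -n to n contains [n.+1] letters of the right-ray, counting position 0. *)
have [y' [x' [yy' xx' Xyx]]] := yx n.+1.
exists (ray_cat y' x'); split=> // -[] k kn /=; first by rewrite xx'.
by rewrite yy' // ltnW.
Qed.

Lemma P_infty_closed x y :
  (forall n, exists y', agree n y' y /\ P_infty X x y') -> P_infty X x y.
Proof.
rewrite P_inftyE => cl; apply: ray_cat_closed => n.
by have [y' [yy' Xy']] := cl n; exists y', x.
Qed.

End Predecessors.

(** * Infinite paths in labelled graphs and their labels *)

Section Graphs.
Variables (A : finType) (G : lgraph A).
Implicit Types (x y : nat -> A) (z : int -> A) (a : A) (v w : vert G).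

(** The predecessor set of [v] without the condition that its elements be left-rays of a shift, so
    that it depends on the graph only. *)
Definition predecessor_labels v : set (nat -> A) :=
  [set y | exists e : nat -> edge G,
     left_infinite_path_to v e /\ forall n, y n = lab (e n)].

Definition starts x v : Prop :=
  exists e : nat -> edge G, [/\ src (e 0%N) = v,
    forall n, rng (e n) = src (e n.+1) & forall n, x n = lab (e n)].

Lemma predecessor_labels_cons a y v : predecessor_labels v (ray_cons a y) <->
  exists e, [/\ rng e = v, lab e = a & predecessor_labels (src e) y].
Proof.
split=> [[e [[e0 eS] ye]]|[e [<- <- [f [[f0 fS] yf]]]]].
  exists (e 0%N); split=> //; first by rewrite -ye.
  exists (fun n => e n.+1); split=> [|n]; first by split=> // n; rewrite eS.
  by rewrite -ye.
exists (fun n => if n is m.+1 then f m else e).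
by split=> [|[]//]; split=> // -[].
Qed.

Lemma starts_cons a x v : starts (ray_cons a x) v <->
  exists e, [/\ src e = v, lab e = a & starts x (rng e)].
Proof.
split=> [[e [e0 eS xe]]|[e [<- <- [f [f0 fS xf]]]]].
  exists (e 0%N); split=> //; first by rewrite -xe.
  exists (fun n => e n.+1); split=> [|n|n]; by rewrite -?xe -?eS.
by exists (fun n => if n is m.+1 then f m else e); split=> [//|[]|[]].
Qed.

(** Coinduction: iterating the step on pairs of a vertex and a left-ray still to be read builds the
    path backwards, edge by edge. *)
Lemma predecessor_labels_coind (R : vert G -> set (nat -> A)) :
  (forall v y, R v y ->
     exists e, [/\ rng e = v, lab e = y 0%N & R (src e) (tail y)]) ->
  forall v, R v `<=` predecessor_labels v.
Proof.
move=> step v0 y0 R0.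
pose St := {s : vert G * (nat -> A) | R s.1 s.2}.
have /choice[e eP] : forall s : St, exists e, [/\ rng e = (sval s).1,
    lab e = (sval s).2 0%N & R (src e) (tail (sval s).2)].
  by move=> [[v y] /= Rvy]; exact: step.
pose next (s : St) : St :=
  exist _ (src (e s), tail (sval s).2) (let: And3 _ _ r := eP s in r).
pose s n := iter n next (exist _ (v0, y0) R0 : St).
have sE n m : (sval (s n)).2 m = y0 (n + m)%N.
  by elim: n m => // n IH m; rewrite /= /tail IH addnS.
exists (fun n => e (s n)); split=> [|n]; last first.
  by have [_ -> _] := eP (s n); rewrite sE addn0.
split=> [|n]; first by have [-> _ _] := eP (s 0%N).
by have [-> _ _] := eP (s n.+1).
Qed.

Lemma predecessor_labels_residual (e : edge G) : left_resolving G ->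
  predecessor_labels (src e) = residual (lab e) (predecessor_labels (rng e)).
Proof.
move=> lr; apply/seteqP; split=> y /=.
  by move=> ye; apply/predecessor_labels_cons; exists e.
by move=> /predecessor_labels_cons[f [fr fl]]; rewrite (lr _ _ fr fl).
Qed.

Section Presentation.
Variable X : set (int -> A).
Hypothesis GX : presents G X.

Lemma presents_ray_cat y x :
  X (ray_cat y x) <-> exists v, predecessor_labels v y /\ starts x v.
Proof.
rewrite GX; split=> [[e [ep ze]]|[v [[l [[l0 lS] yl]] [r [r0 rS xr]]]]].
  exists (src (e 0)); split.
    exists (fun n => e (Negz n)); split=> [|n]; last exact: (ze (Negz n)).
    split=> [|n]; first by rewrite ep.
    by rewrite ep; congr (src (e _)); lia.
  exists (fun n => e (Posz n)); split=> // [n|n]; last exact: (ze (Posz n)).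
  by rewrite ep -PoszD addn1.
exists (fun i => match i with Posz n => r n | Negz n => l n end).
split=> -[n|n] //.
- by rewrite -PoszD addn1.
- case: n => [|n]; first by rewrite l0 r0.
  have -> : Negz n.+1 + 1 = Negz n by lia.
  exact: lS.
- exact: xr.
- exact: yl.
Qed.

Lemma P_infty_starts x :
  P_infty X x = \bigcup_(v in [set v | starts x v]) predecessor_labels v.
Proof.
rewrite P_inftyE; apply/seteqP; split=> y /=.
  by move=> /presents_ray_cat[v [yv xv]]; exists v.
by move=> [v xv yv]; apply/presents_ray_cat; exists v.
Qed.

(** The predecessor set of [x] depends only on the set of vertices where [x] starts, and there are
    finitely many such sets. *)
Lemma finite_P_infty : finite_lgraph G ->
  exists (I : finType) (F : I -> set (nat -> A)),
    forall x, exists i, P_infty X x = F i.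
Proof.
move=> [/finite_setT_inj[I [h hinj]] _].
exists {set I}, (fun S : {set I} =>
  \bigcup_(v in [set v | h v \in S]) predecessor_labels v) => x.
exists [set i | `[<exists2 v, starts x v & h v = i>]]%SET.
rewrite P_infty_starts; congr bigcup; apply/seteqP; split=> v /=.
  by move=> xv; rewrite inE; apply/asboolP; exists v.
by rewrite inE => /asboolP[w xw /hinj <-].
Qed.

End Presentation.
End Graphs.

(* When [G] is left-resolving, its edges are determined by source, label and
   range; if moreover these triples are read off the sets [RG], then so is the
   whole graph. *)
Lemma iso_of_adjacency (A : finType) (G H : lgraph A)
    (RG : vert G -> set (nat -> A)) (RH : vert H -> set (nat -> A))
    (f : vert G -> vert H) :
  left_resolving G -> left_resolving H ->
  (forall v a w, (exists e, [/\ src e = v, lab e = a & rng e = w]) <->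
     RG v = residual a (RG w)) ->
  (forall v a w, (exists e, [/\ src e = v, lab e = a & rng e = w]) <->
     RH v = residual a (RH w)) ->
  bijective f -> (forall v, RH (f v) = RG v) ->
  exists g : edge G -> edge H, is_isomorphism f g.
Proof.
move=> lrG lrH adjG adjH bf Rf.
have /choice[g gP] : forall e : edge G, exists e' : edge H,
    [/\ src e' = f (src e), lab e' = lab e & rng e' = f (rng e)].
  by move=> e; apply/adjH; rewrite !Rf; apply/adjG; exists e.
exists g; split=> // [|e|e|e]; [|by have [] := gP e|by have [] := gP e|by have [] := gP e].
apply: inj_surj_bijective => [e1 e2 g12|e'].
  have [_ l1 r1] := gP e1; have [_ l2 r2] := gP e2.
  apply: lrG; last by rewrite -l1 -l2 g12.
  by apply: (bij_inj bf); rewrite -r1 -r2 g12.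
have [f' fK f'K] := bf.
have /adjG[e [se le re]] :
    RG (f' (src e')) = residual (lab e') (RG (f' (rng e'))).
  by rewrite -!Rf !f'K; apply/adjH; exists e'.
exists e; have [_ l1 r1] := gP e; apply: lrH; last by rewrite l1.
by rewrite r1 re f'K.
Qed.

(** Nonemptiness of the set at [v] yields an edge into [w] labelled [a]; its source has the same set
    as [v], so it is [v]. *)
Lemma adjacency_predecessor_labels (A : finType) (G : lgraph A) :
  left_resolving G -> injective (@predecessor_labels A G) ->
  (forall v : vert G, predecessor_labels v !=set0) ->
  forall (v : vert G) a w, (exists e, [/\ src e = v, lab e = a & rng e = w]) <->
    predecessor_labels v = residual a (predecessor_labels w).
Proof.
move=> lr inj ne v a w; split=> [[e [<- <- <-]]|vw].
  exact: predecessor_labels_residual.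
have [y] := ne v; rewrite {1}vw => /predecessor_labels_cons[e [re le _]].
exists e; split=> //; apply: inj.
by rewrite predecessor_labels_residual // vw re le.
Qed.

(** * The generalised left Fischer cover as a graph of sets of left-rays *)

Section FischerSets.
Variables (A : finType) (X : set (int -> A)).
Hypothesis HX : shift_space X.
Implicit Types (x y : nat -> A) (z : int -> A) (a : A) (P Q : set (nat -> A)).
Let K := left_krieger_cover X.
Let G := generalised_left_fischer_cover X.

(* The vertices of the generalised left Fischer cover, as sets of left-rays. *)
Inductive fischer_set : set (nat -> A) -> Prop :=
| fischer_indecomposable (Q : krieger_vertex X) :
    indecomposable Q -> fischer_set (sval Q)
| fischer_residual a P :
    residual a P !=set0 -> fischer_set P -> fischer_set (residual a P).

Lemma krieger_nonempty (Q : krieger_vertex X) : sval Q !=set0.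
Proof. by case: Q => P [x [Xx Px]] /=; rewrite Px; apply/right_rays_ray. Qed.

Lemma krieger_vertex_of x : P_infty X x !=set0 ->
  exists Q : krieger_vertex X, sval Q = P_infty X x.
Proof.
move=> /right_rays_ray Xx.
by exists (exist _ (P_infty X x) (ex_intro _ x (conj Xx erefl))).
Qed.

Lemma fischer_set_krieger P : fischer_set P ->
  exists x, P = P_infty X x /\ P !=set0.
Proof.
elim=> [Q _|a {}P ne _ [x [Px _]]].
  have Qne := krieger_nonempty Q.
  by case: Q Qne => Q [x [Xx Qx]] /= Qne; exists x.
by exists (ray_cons a x); rewrite P_infty_cons // -Px.
Qed.

(** Any right-ray [x] representing [w] will do, since the predecessor set of [ray_cons a x] depends
    only on that of [x]. *)
Lemma krieger_adjacency (v : vert K) a (w : vert K) :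
  (exists e : edge K, [/\ src e = v, lab e = a & rng e = w]) <->
  sval v = residual a (sval w).
Proof.
split=> [[[[[v' a'] w'] [x /= [Xx vx wx]]] /= [<- <- <-]]|vw].
  by rewrite vx wx P_infty_cons.
have [x [Xx wx]] := svalP w.
have e : exists x, [/\ right_rays X x,
    sval (v, a, w).1.1 = P_infty X (ray_cons (v, a, w).1.2 x)
  & sval (v, a, w).2 = P_infty X x].
  by exists x; rewrite /= P_infty_cons // -wx.
by exists (exist _ (v, a, w) e).
Qed.

(** Going back along one edge takes one residual, so a path to an indecomposable vertex is a chain
    of nonempty residuals. *)
Lemma fischer_setP (v : vert K) :
  (exists Q : krieger_vertex X, indecomposable Q /\ @reaches A K v Q) <->
  fischer_set (sval v).
Proof.
split=> [[Q [indQ vQ]]|].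
  have := fischer_indecomposable indQ; elim: vQ => {indQ}[|//|]; last first.
    by move=> u v' w _ IHu _ IHw /IHw.
  move=> u w [e [eu ew]] fw.
  have uw : sval u = residual (lab e) (sval w).
    by apply/krieger_adjacency; exists e.
  rewrite uw; apply: fischer_residual => //; rewrite -uw.
  exact: krieger_nonempty.
move vP : (sval v) => P fP; elim: fP v vP => [Q indQ v /sval_inj ->|].
  by exists Q; split=> //; exact: rt_refl.
move=> a {}P _ fP IH v vP; have [x [Px Pne]] := fischer_set_krieger fP.
rewrite Px in Pne; have [w wx] := krieger_vertex_of Pne.
have [|Q [indQ wQ]] := IH w; first by rewrite wx.
exists Q; split=> //; apply: rt_trans wQ; apply: rt_step.
have /krieger_adjacency[e [se le re]] : sval v = residual a (sval w).
  by rewrite vP wx Px.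
by exists e.
Qed.

Lemma glfc_rays_inj : injective (@glfc_rays A X).
Proof. by move=> v w /sval_inj/sval_inj. Qed.

Lemma glfc_rays_fischer (v : vert G) : fischer_set (glfc_rays v).
Proof. by apply/fischer_setP; case: v. Qed.

Lemma glfc_rays_nonempty (v : vert G) : glfc_rays v !=set0.
Proof. exact: krieger_nonempty. Qed.

Lemma glfc_vertex_of P : fischer_set P -> exists v : vert G, glfc_rays v = P.
Proof.
move=> fP; have [x [Px Pne]] := fischer_set_krieger fP.
rewrite Px in Pne; have [w wx] := krieger_vertex_of Pne.
have wf : exists Q : krieger_vertex X, indecomposable Q /\ @reaches A K w Q.
  by apply/fischer_setP; rewrite wx -Px.
by exists (exist _ w wf); rewrite /glfc_rays /= wx.
Qed.

Lemma glfc_adjacency (v : vert G) a (w : vert G) :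
  (exists e : edge G, [/\ src e = v, lab e = a & rng e = w]) <->
  glfc_rays v = residual a (glfc_rays w).
Proof.
rewrite /glfc_rays -krieger_adjacency.
split=> [[[e [es er]] /= [<- <- <-]]|]; first by exists e.
case: v w => [v vf] [w wf] /= [e [ev ea ew]]; subst v w.
by exists (exist _ e (conj vf wf)); split=> //; exact: sval_inj.
Qed.

Lemma glfc_left_resolving : left_resolving G.
Proof.
move=> [[[[v a] w] /= e] /= [ev ew]] [[[[v' a'] w'] /= f] /= [fv fw]] /=.
move=> /(congr1 sval) /= ww' aa'; subst w' a'.
apply/sval_inj => /=; apply/sval_inj => /=; congr (_, _, _); apply: sval_inj.
have [x [_ -> wx]] := e; have [x' [_ -> wx']] := f.
by rewrite !P_infty_cons // -wx -wx'.
Qed.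

Lemma fischer_set_cons P a y : fischer_set P -> P (ray_cons a y) ->
  fischer_set (residual a P).
Proof. by move=> fP Pay; apply: fischer_residual => //; exists y. Qed.

(* Closedness of [X] turns approximation of a left-infinite label by elements
   of the set [glfc_rays v] into membership. *)
Lemma glfc_predecessor_labels (v : vert G) : predecessor_labels v = glfc_rays v.
Proof.
apply/seteqP; split; last first.
  apply: (@predecessor_labels_coind A G (@glfc_rays A X)) => {}v y vy.
  rewrite -(ray_consK y) in vy.
  have [w wv] := glfc_vertex_of (fischer_set_cons (glfc_rays_fischer v) vy).
  have /glfc_adjacency[e [se le re]] := wv.
  by exists e; split=> //; rewrite se wv.
move=> y yv; have [x [vx _]] := fischer_set_krieger (glfc_rays_fischer v).
rewrite vx; apply: P_infty_closed => // n; rewrite -vx => {x vx}.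
(* After [n] edges backwards, any element of the nonempty set at the vertex reached completes the
   approximation. *)
elim: n v y yv => [|n IH] v y yv.
  by have [t vt] := glfc_rays_nonempty v; exists t.
move: yv; rewrite -(ray_consK y) => /predecessor_labels_cons[e [re le]].
move=> /IH[t [ty ut]]; exists (ray_cons (lab e) t); rewrite le; split.
  exact: agree_ray_cons.
have /glfc_adjacency er : exists e', [/\ src e' = src e, lab e' = y 0%N & rng e' = v].
  by exists e.
by move: ut; rewrite er.
Qed.

Lemma glfc_rays_left_rays (v : vert G) : glfc_rays v `<=` left_rays X.
Proof.
have [x [-> _]] := fischer_set_krieger (glfc_rays_fischer v).
by move=> y [].
Qed.

Lemma glfc_predecessor_separated : predecessor_separated X G.
Proof.
have E (v : vert G) : predecessor_set X v = glfc_rays v.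
  rewrite -glfc_predecessor_labels; apply/seteqP; split=> y; first by case.
  move=> yv; split=> //; apply: (@glfc_rays_left_rays v).
  by rewrite -glfc_predecessor_labels.
by move=> v w; rewrite !E => /glfc_rays_inj.
Qed.

(** The path is cut after position [n]; its left label lies in some [P_infty X x], so following it
    by [x] gives a point of [X] that agrees with [z] up to [n]. *)
Lemma glfc_path_label (e : int -> edge G) :
  biinfinite_path e -> X (fun i => lab (e i)).
Proof.
move=> ep; set z := fun i => _; apply: approx_mem => // n.
pose v := rng (e n%:Z).
have : predecessor_labels v (left_ray (shift_by n.+1%:Z z)).
  exists (fun k => e (n%:Z - k%:Z)); split=> [|k].
    split=> [|k]; first by rewrite subr0.
    by rewrite ep; congr (src (e _)); lia.
  by rewrite /left_ray /shift_by /z; congr (lab (e _)); lia.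
rewrite glfc_predecessor_labels.
have [x [-> _]] := fischer_set_krieger (glfc_rays_fischer v).
rewrite P_inftyE /=; set zx := ray_cat _ _ => Xzx.
exists (shift_by (- n.+1%:Z) zx); split=> [|i ni]; first exact/shift_by_mem.
have [k ik] : exists k, i - n.+1%:Z = Negz k by exists `|n%:Z - i|%N; lia.
by rewrite /shift_by ik /zx /= /left_ray /shift_by -ik; congr z; lia.
Qed.

End FischerSets.

(** * Minimisation and compactness *)

Lemma exists_argmin (T : Type) (R : T -> Prop) (c : T -> nat) :
  (exists t, R t) -> exists2 t, R t & forall t', R t' -> (c t <= c t')%N.
Proof.
move=> [t0 Rt0].
have ex : exists n, `[<exists2 t, R t & c t = n>].
  by exists (c t0); apply/asboolP; exists t0.
case: (ex_minnP ex) => n /asboolP[t Rt ct] nmin; exists t => // t' Rt'.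
by rewrite ct; apply: nmin; apply/asboolP; exists t'.
Qed.

(* Compactness: the biinfinite path is an ultrafilter limit of left-infinite
   paths ending further and further to the right. *)
Lemma biinfinite_path_limit (A : finType) (G : lgraph A) (I : finType)
    (h : vert G -> I) (z : int -> A) : injective h ->
  (forall n : nat, exists v : vert G,
     predecessor_labels v (left_ray (shift_by n%:Z z))) ->
  exists e : int -> edge G, biinfinite_path e /\ forall i, z i = lab (e i).
Proof.
move=> hinj zP.
have /choice[e eP] : forall n : nat, exists e : nat -> edge G,
    (forall k, rng (e k.+1) = src (e k)) /\
    forall k, z (n%:Z - k.+1%:Z) = lab (e k).
  move=> n; have [v [e [[_ eS] ze]]] := zP n.
  by exists e; split=> // k; rewrite -ze /left_ray /shift_by NegzE addrC.
(* For [i < n] this is the edge of the n-th path that carries the letter [z i]; other values are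
   junk. The ultrafilter then fixes the range vertex at each position, and edges between these
   vertices are chosen afterwards. *)
pose E (n : nat) (i : int) := e n `|(n%:Z - 1 - i)%R|%N.
have [U [UU ooU]] := ultraFilterLemma eventually_filter.
have /choice[w wP] : forall i, exists v, U [set n | rng (E n i) = v].
  by move=> i; apply: ultra_fin_eq hinj.
have /choice[f fP] : forall i, exists e : edge G,
    [/\ src e = w (i - 1), z i = lab e & rng e = w i].
  move=> i.
  have Ui : U [set n : nat | (`|i| < n)%N] by apply: ooU; exists (`|i|.+1)%N.
  have [n [[<- <-] /= ni]] := filter_ex (filterI (filterI (wP (i - 1)) (wP i)) Ui).
  have ek : `|(n%:Z - 1 - (i - 1))%R|%N = `|(n%:Z - 1 - i)%R|%N.+1 by lia.
  exists (E n i); split=> //; first by rewrite /E ek (eP n).1.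
  by rewrite -(eP n).2; congr z; lia.
exists f; split=> i; last by have [] := fP i.
have [_ _ ->] := fP i; have [-> _ _] := fP (i + 1).
by rewrite addrK.
Qed.

(** * Presentation by the cover, and synchronizing rays *)

Section FinitelyManyPredecessorSets.
Variables (A : finType) (X : set (int -> A)).
Hypothesis HX : shift_space X.
Variables (I : finType) (F : I -> set (nat -> A)).
Hypothesis finP : forall x, exists i, P_infty X x = F i.
Implicit Types (x y : nat -> A) (z : int -> A) (a : A).
Let G := generalised_left_fischer_cover X.

(** Counting the indices [i] with [F i] inside the predecessor set of [x] turns minimality under
    inclusion into a minimum of natural numbers. *)
Lemma exists_minimal_P_infty (R : (nat -> A) -> Prop) : (exists x, R x) ->
  exists2 x, R x &
    forall x', R x' -> P_infty X x' `<=` P_infty X x -> P_infty X x' = P_infty X x.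
Proof.
pose below x := [set i | `[<F i `<=` P_infty X x>]]%SET.
move=> /(exists_argmin (fun x => #|below x|))[x Rx xmin].
exists x => // x' Rx' x'x; apply/seteqP; split=> //.
have [i xi] := finP x; rewrite {1}xi.
suff : i \in below x' by rewrite !inE.
have sub : below x' \subset below x.
  apply/fintype.subsetP => j; rewrite !inE => jx'.
  exact: subset_trans x'x.
have /eqP -> : below x' == below x by rewrite eqEcard sub xmin.
by rewrite !inE xi.
Qed.

(** A minimal predecessor set containing [y] is indecomposable: in a union some piece contains [y],
    and by minimality it is the whole. *)
Lemma glfc_cover x y : P_infty X x y -> exists v : vert G, glfc_rays v y.
Proof.
move=> Pxy.
have [|x' x'y xmin] := @exists_minimal_P_infty (fun x => P_infty X x y).
  by exists x.
have ne : P_infty X x' !=set0 by exists y.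
have [Q Qx'] := krieger_vertex_of ne.
have indQ : indecomposable Q.
  move=> V QV; have : sval Q y by rewrite Qx'.
  rewrite QV => -[Q' VQ' Q'y].
  suff <- : Q' = Q by [].
  apply: sval_inj; have [x'' [_ Q'x'']] := svalP Q'.
  rewrite Q'x'' Qx'; apply: xmin; first by rewrite -Q'x''.
  by rewrite -Q'x'' -Qx' QV => t Q't; exists Q'.
have [v vQ] := glfc_vertex_of HX (fischer_indecomposable indQ).
by exists v; rewrite vQ Qx'.
Qed.

Lemma glfc_finite : exists h : vert G -> I, injective h.
Proof.
have /choice[h hP] : forall v : vert G, exists i, glfc_rays v = F i.
  move=> v; have [x [-> _]] := fischer_set_krieger HX (glfc_rays_fischer HX v).
  exact: finP.
by exists h => v w vw; apply: glfc_rays_inj; rewrite !hP vw.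
Qed.

Lemma glfc_presents : presents G X.
Proof.
apply/seteqP; split=> z; last first.
  by move=> [e [ep ze]]; rewrite (funext ze); exact: glfc_path_label.
move=> Xz; have [h hinj] := glfc_finite.
apply: biinfinite_path_limit hinj _ => n.
have Xnz : X (shift_by n%:Z z) by apply/shift_by_mem.
have [v vz] := glfc_cover (P_infty_left_ray Xnz).
by exists v; rewrite glfc_predecessor_labels.
Qed.

(** Each [F i] either occurs arbitrarily close to [x], hence lies in [P_infty X x] by closedness, or
    is excluded near [x]; the maximum of the finitely many bounds serves all [i]. *)
Lemma P_infty_upper_semicontinuous x :
  exists n, forall x', agree n x' x -> P_infty X x' `<=` P_infty X x.
Proof.
have /choice[N NP] : forall i, exists n, forall x', agree n x' x ->
    P_infty X x' = F i -> F i `<=` P_infty X x.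
  move=> i; apply: contrapT => nn; apply: (nn); exists 0%N => x' _ _ y Fy.
  rewrite P_inftyE; apply: ray_cat_closed => // n.
  apply: contrapT => nx; apply: nn; exists n => x'' xx'' Px''.
  case: nx; exists y, x''; split=> //.
  by have : P_infty X x'' y by [rewrite Px'']; rewrite P_inftyE.
exists (\max_i N i)%N => x' x'x; have [i x'i] := finP x'.
rewrite x'i; apply: NP x'i; apply: agree_le x'x; exact: leq_bigmax.
Qed.

Lemma P_infty_uniformly_closed y :
  exists n, forall x' y', agree n y' y -> P_infty X x' y' -> P_infty X x' y.
Proof.
have /choice[N NP] : forall i, exists n, forall x' y', agree n y' y ->
    P_infty X x' = F i -> F i y' -> F i y.
  move=> i; apply: contrapT => nn; apply: (nn); exists 0%N => x' _ _ x'i _.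
  rewrite -x'i; apply: P_infty_closed => // n.
  apply: contrapT => ny; apply: nn; exists n => x'' y' yy' x''i Fy'.
  by case: ny; exists y'; rewrite x'i.
exists (\max_i N i)%N => x' y' y'y; have [i x'i] := finP x'.
rewrite x'i; apply: NP x'i; apply: agree_le y'y; exact: leq_bigmax.
Qed.

(* [P_infty X] is locally constant at [x]: equivalently, some prefix of [x] is
   an intrinsically synchronizing word. *)
Definition synchronizing x := P_infty X x !=set0 /\
  exists n, forall x', P_infty X x' !=set0 -> agree n x' x ->
    P_infty X x' = P_infty X x.

Lemma synchronizing_agree x : synchronizing x ->
  exists n, forall x', P_infty X x' !=set0 -> agree n x' x ->
    P_infty X x' = P_infty X x /\ synchronizing x'.
Proof.
move=> [_ [n xn]]; exists n => x' ne' x'x; split; first exact: xn.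
split=> //; exists n => x'' ne'' x''x'.
by rewrite (xn _ ne' x'x); apply: xn => // i ilt; rewrite x''x' // x'x.
Qed.

Lemma synchronizing_cons a x : synchronizing x ->
  P_infty X (ray_cons a x) !=set0 -> synchronizing (ray_cons a x).
Proof.
move=> [_ [n xn]] ne; split=> //; exists n.+1 => x' ne' /agreeS[/= x'a x'x].
move: ne'; rewrite -(ray_consK x') x'a !P_infty_cons // => ne'.
by rewrite xn //; case: ne' => y; exists (ray_cons a y).
Qed.

(** A minimal nonempty predecessor set could only shrink nearby, by upper semicontinuity, hence
    stays constant. *)
Lemma exists_synchronizing x : P_infty X x !=set0 -> exists x', synchronizing x'.
Proof.
move=> ne; have [|x' ne' xmin] :=
  @exists_minimal_P_infty (fun x => P_infty X x !=set0); first by exists x.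
exists x'; split=> //; have [n xn] := P_infty_upper_semicontinuous x'.
by exists n => x'' ne'' /xn; exact: xmin.
Qed.

Lemma right_ray_cons_ind (T : (nat -> A) -> Prop) :
  (forall a x, T x -> P_infty X (ray_cons a x) !=set0 -> T (ray_cons a x)) ->
  forall (n : nat) z, X z -> T (right_ray (shift_by n%:Z z)) -> T (right_ray z).
Proof.
move=> Tcons; elim=> [|n IH] z Xz; first by rewrite shift_by0.
have -> : shift_by n.+1%:Z z = shift_by n%:Z (shift z).
  by apply: funext => i; rewrite /shift /shift_by; congr z; lia.
move=> /(IH (shift z)) Tz; rewrite right_ray_shift; apply: Tcons.
  by apply: Tz; apply/HX.2.
by rewrite -right_ray_shift; exists (left_ray z); exact: P_infty_left_ray.
Qed.

(** * Irreducible shifts: synchronizing rays everywhere *)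

Section Irreducible.
Hypothesis irrX : irreducible_shift X.

Lemma irreducible_transition z z0 (n n0 : nat) : X z -> X z0 ->
  exists z' (k : nat), [/\ X z', forall i, (i < n)%N -> z' i%:Z = z i%:Z &
    forall i, (i < n0)%N -> z' (n + k + i)%N%:Z = z0 i%:Z].
Proof.
move=> Xz Xz0.
have lang (u : int -> A) m : X u -> language X (mkseq (fun k => u k%:Z) m).
  move=> Xu; exists u, 0; split=> //; rewrite size_mkseq.
  by apply: eq_mkseq => k; rewrite add0r.
have [v [z' [i [Xz' e]]]] := irrX (lang _ n Xz) (lang _ n0 Xz0).
exists (shift_by i z'), (size v); split; first exact/shift_by_mem.
- move=> j jn; have /(congr1 (fun s => nth (z 0) s j)) := e.
  rewrite nth_cat size_mkseq jn !nth_mkseq //; last first.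
    by rewrite size_cat size_mkseq ltn_addr.
  by rewrite /shift_by addrC.
- move=> j jn; have /(congr1 (fun s => nth (z 0) s (n + size v + j)%N)) := e.
  rewrite nth_cat size_mkseq -addnA ltnNge leq_addr /= addKn.
  rewrite nth_cat ltnNge leq_addr /= addKn !nth_mkseq //; last first.
    by rewrite !size_cat !size_mkseq !ltn_add2l.
  by move=> ->; rewrite /shift_by addrC.
Qed.

(** The [M] letters of [y] and [N] letters of [x] around the origin are continued to a synchronizing
    prefix. [M] keeps [y] in the new predecessor set, [N] keeps this set inside that of [x], and
    prepending letters preserves synchronization. *)
Lemma synchronizing_cover x y : P_infty X x y ->
  exists x', [/\ synchronizing x', P_infty X x' y & P_infty X x' `<=` P_infty X x].
Proof.
move=> Pxy; have [|x0 x0s] := @exists_synchronizing x; first by exists y.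
have [n0 x0n] := synchronizing_agree x0s.
have [z0 Xz0 z0x] : right_rays X x0 by apply/right_rays_ray; case: x0s.
have [M yM] := P_infty_uniformly_closed y.
have [N xN] := P_infty_upper_semicontinuous x.
have Xyx : X (ray_cat y x) by move: Pxy; rewrite P_inftyE.
have Xs : X (shift_by (- M%:Z) (ray_cat y x)) by apply/shift_by_mem.
have [z' [k [Xz' z'l z'r]]] := irreducible_transition (M + N) n0 Xs Xz0.
have X1 : X (shift_by M%:Z z') by apply/shift_by_mem.
have x1x : agree N (right_ray (shift_by M%:Z z')) x.
  move=> i iN; rewrite /right_ray /shift_by.
  have -> : i%:Z + M%:Z = (M + i)%N%:Z by lia.
  rewrite z'l ?ltn_add2l // /shift_by.
  by have -> : (M + i)%N%:Z - M%:Z = i%:Z by lia.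
have y1y : agree M (left_ray (shift_by M%:Z z')) y.
  move=> i iM; rewrite /left_ray /shift_by.
  have -> : Negz i + M%:Z = (M - i.+1)%N%:Z by lia.
  rewrite z'l /shift_by; last by lia.
  by have -> : (M - i.+1)%N%:Z - M%:Z = Negz i by lia.
exists (right_ray (shift_by M%:Z z')); split.
- apply: (@right_ray_cons_ind synchronizing _ (N + k)%N _ X1).
    by move=> a t; exact: synchronizing_cons.
  have Xt : X (shift_by (N + k)%N%:Z (shift_by M%:Z z')).
    exact: (shift_by_mem HX _ _).2 X1.
  apply: (x0n _ _ _).2; first exact: P_infty_right_ray_nonempty.
  move=> i iN; rewrite -z0x /right_ray /shift_by -z'r //; congr z'; lia.
- exact: yM y1y (P_infty_left_ray X1).
- exact: xN.
Qed.

(** [Q] is the union of the synchronizing predecessor sets that it contains, so it is one of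
    them. *)
Lemma indecomposable_synchronizing (Q : krieger_vertex X) : indecomposable Q ->
  exists2 x, synchronizing x & sval Q = P_infty X x.
Proof.
pose V := [set Q' : krieger_vertex X | sval Q' `<=` sval Q /\
  exists2 x, synchronizing x & sval Q' = P_infty X x].
move=> indQ; suff [] : V Q by [].
apply: indQ; apply/seteqP; split=> y; last by move=> [Q' [Q'Q _] /Q'Q].
have [x [_ Qx]] := svalP Q; rewrite Qx => /synchronizing_cover[x' [x's x'y x'x]].
have [Q' Q'x'] := krieger_vertex_of (ex_intro _ y x'y : P_infty X x' !=set0).
exists Q'; last by rewrite Q'x'.
by split; [rewrite Q'x' Qx | exists x'].
Qed.

Lemma fischer_set_synchronizing P : fischer_set X P ->
  exists2 x, synchronizing x & P = P_infty X x.
Proof.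
elim=> [Q|a {}P ne _ [x xs Px]]; first exact: indecomposable_synchronizing.
exists (ray_cons a x); last by rewrite P_infty_cons // -Px.
by apply: synchronizing_cons; rewrite // P_infty_cons // -Px.
Qed.

(* Irreducibility leads from a synchronizing prefix of [x] to [x0], and
   prepending a synchronizing prefix of [x] determines the predecessor set. *)
Lemma synchronizing_transport (T : (nat -> A) -> Prop) x x0 :
  (forall a t, T t -> P_infty X (ray_cons a t) !=set0 -> T (ray_cons a t)) ->
  synchronizing x -> synchronizing x0 -> T x0 ->
  exists2 x', T x' & P_infty X x' = P_infty X x.
Proof.
move=> Tcons [/right_rays_ray[z Xz zx] [n xn]].
move=> [/right_rays_ray[z0 Xz0 z0x] [n0 x0n]] Tx0.
have [z' [k [Xz' z'l z'r]]] := irreducible_transition n n0 Xz Xz0.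
pose z1 := shift_by (n + k)%N%:Z z'.
have X1 : X z1 by apply/shift_by_mem.
have P1 : P_infty X (right_ray z1) = P_infty X x0.
  apply: x0n; first exact: P_infty_right_ray_nonempty.
  by move=> i ilt; rewrite -z0x /right_ray -z'r // /z1 /shift_by; congr z'; lia.
(* The left half of [z1], which carries the prefix of [x], can be followed by [x0] itself, the ray
   for which [T] is known. *)
have Xw : X (ray_cat (left_ray z1) x0).
  by have := P_infty_left_ray X1; rewrite P1 P_inftyE.
pose w := shift_by (- (n + k)%N%:Z) (ray_cat (left_ray z1) x0).
have Xw' : X w by apply/shift_by_mem.
exists (right_ray w).
  apply: (right_ray_cons_ind Tcons (n := (n + k)%N) Xw').
  by rewrite /w shift_byD subrr shift_by0.
apply: xn; first exact: P_infty_right_ray_nonempty.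
move=> i ilt; rewrite -zx /right_ray -z'l // /w /shift_by.
have [j ij] : exists j, i%:Z - (n + k)%N%:Z = Negz j by exists (n + k - i).-1; lia.
by rewrite ij /= /left_ray /z1 /shift_by -ij; congr z'; lia.
Qed.

(** * Vertices of a finite left-resolving presentation *)

Section Minimality.
Variables (H : lgraph A) (J : finType) (h : vert H -> J).
Hypotheses (hinj : injective h) (lrH : left_resolving H) (HX' : presents H X).

(** Vertices are coded in [J] so that those where [x] starts can be counted. *)
Let S x := [set j | `[<exists2 v : vert H, starts x v & h v = j>]]%SET.

Lemma mem_starts x v : (h v \in S x) = `[<starts x v>].
Proof.
rewrite !inE; apply/asboolP/asboolP => [[w xw /hinj <-]//|xv].
by exists v.
Qed.

(** On codes, [m] sends each source to the range of a chosen edge labelled [a]; it is injective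
    because [H] is left-resolving. *)
Lemma starts_cons_inj a x : exists m : J -> J, {in S (ray_cons a x) &, injective m} /\
  forall j, j \in S (ray_cons a x) -> exists e : edge H,
    [/\ lab e = a, starts x (rng e), h (src e) = j & h (rng e) = m j].
Proof.
have /choice[m mP] : forall j, exists i, j \in S (ray_cons a x) ->
    exists e : edge H, [/\ lab e = a, starts x (rng e), h (src e) = j & h (rng e) = i].
  move=> j; have [|nj] := boolP (j \in S (ray_cons a x)); last by exists j.
  rewrite !inE => -[v /starts_cons[e [ev le xe]] vj].
  by exists (h (rng e)) => _; exists e; rewrite ev.
exists m; split=> // i j iS jS mij.
have [e [le _ ei em]] := mP _ iS; have [f [lf _ fj fm]] := mP _ jS.
rewrite -ei -fj; congr (h (src _)).
by apply: lrH; [apply: hinj; rewrite em fm | rewrite le lf].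
Qed.

Lemma card_starts_cons a x : (#|S (ray_cons a x)| <= #|S x|)%N.
Proof.
have [m [minj mP]] := starts_cons_inj a x.
rewrite -(card_in_imset minj); apply: subset_leq_card.
apply/fintype.subsetP => _ /imsetP[j /mP[e [_ xe _ <-]] ->].
by rewrite mem_starts; apply/asboolP.
Qed.

(** The injection of [starts_cons_inj] is then onto, so [v] is the range of one of the chosen
    edges. *)
Lemma card_starts_cons_eq a x v : (#|S x| <= #|S (ray_cons a x)|)%N ->
  starts x v ->
  exists e : edge H, [/\ rng e = v, lab e = a & starts (ray_cons a x) (src e)].
Proof.
have [m [minj mP]] := starts_cons_inj a x.
move=> Sle xv.
have sub : m @: S (ray_cons a x) \subset S x.
  apply/fintype.subsetP => _ /imsetP[j /mP[e [_ xe _ <-]] ->].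
  by rewrite mem_starts; apply/asboolP.
have /eqP Sx : m @: S (ray_cons a x) == S x.
  by rewrite eqEcard sub card_in_imset.
have : h v \in S x by rewrite mem_starts; apply/asboolP.
rewrite -Sx => /imsetP[j /mP[e [le xe _ em]] vm].
exists e; split=> //; first by apply: hinj; rewrite em vm.
by apply/starts_cons; exists e.
Qed.

Lemma exists_vertex_predecessor_labels P : fischer_set X P ->
  exists v : vert H, predecessor_labels v = P.
Proof.
move=> /fischer_set_synchronizing[x xs ->].
have [|x0 x0s x0min] := @exists_argmin _ synchronizing (fun x => #|S x|).
  by exists x.
(* Prepending cannot increase the count, and [x0] has the least one, so [T] is preserved. *)
pose T t := synchronizing t /\ #|S t| = #|S x0|.
have Tcons a t : T t -> P_infty X (ray_cons a t) !=set0 -> T (ray_cons a t).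
  move=> [ts tc] /(synchronizing_cons ts) ats; split=> //.
  by apply/eqP; rewrite eqn_leq x0min // andbT -tc card_starts_cons.
have [|x' Tx' <-] := synchronizing_transport Tcons xs x0s; first by [].
have [y x'y] := Tx'.1.1.
have [v x'v yv] : (\bigcup_(v in [set v : vert H | starts x' v]) predecessor_labels v) y.
  by rewrite -(P_infty_starts HX').
exists v; apply/seteqP; split=> [t tv|t x't].
  by rewrite (P_infty_starts HX'); exists v.
(* Invariant: some ray satisfying [T] starts at the vertex and can be preceded by [t]. As the count
   stays constant, the vertex receives an edge with the next letter of [t]. *)
apply: (@predecessor_labels_coind _ _ (fun v t => exists x,
    [/\ T x, starts x v & P_infty X x t])); last by exists x'.
move=> {x' Tx' y x'y v x'v yv t x't} v t [x' [Tx' x'v]].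
rewrite -(ray_consK t) => x't.
have /(Tcons _ _ Tx') Tt : P_infty X (ray_cons (t 0%N) x') !=set0.
  by exists (tail t); rewrite P_infty_cons.
have [|e [re le se]] := @card_starts_cons_eq (t 0%N) x' v _ x'v.
  by rewrite Tx'.2 Tt.2.
exists e; split=> //; exists (ray_cons (t 0%N) x'); split=> //.
by rewrite P_infty_cons.
Qed.

End Minimality.

(** * Comparison with the left Fischer cover *)

Lemma glfc_embedding (H : lgraph A) (J : finType) (h : vert H -> J) :
  injective h -> left_resolving H -> presents H X ->
  exists2 f : vert G -> vert H, injective f &
    forall v, predecessor_labels (f v) = glfc_rays v.
Proof.
move=> hinj lrH HX'.
have /choice[f fP] : forall v : vert G, exists w : vert H,
    predecessor_labels w = glfc_rays v.
  move=> v; apply: (exists_vertex_predecessor_labels hinj) => //.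
  exact: glfc_rays_fischer.
by exists f => // v w vw; apply: glfc_rays_inj; rewrite -!fP vw.
Qed.

Lemma glfc_is_left_fischer_cover : is_left_fischer_cover X G.
Proof.
split; [exact: glfc_left_resolving | exact: glfc_presents | move=> H lrH HX'].
have [/finite_setT_inj[J [h hinj]]|infH] := pselect (finite_set [set: vert H]).
  by have [f finj _] := glfc_embedding hinj lrH HX'; exact: inj_card_leT finj.
by have [h hinj] := glfc_finite; exact: inj_fin_card_le_infinite hinj infH.
Qed.

(** Minimality injects the vertices of [H] into those of the cover, and [glfc_embedding] gives an
    injection [f] back. By finiteness [f] is a bijection; it preserves predecessor sets, and these
    determine the edges. *)
Lemma left_fischer_cover_unique (H : lgraph A) :
  is_left_fischer_cover X H -> isomorphic G H.
Proof.
move=> [lrH HX' Hmin]; have [lrG GX _] := glfc_is_left_fischer_cover.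
have [j jinj] := card_leT_inj (Hmin _ lrG GX).
have [h hinj] := glfc_finite.
have hjinj : injective (h \o j) := inj_comp hinj jinj.
have [f finj fP] := glfc_embedding hjinj lrH HX'.
have fsurj w : exists v, f v = w.
  have fjinj : injective (f \o j) := inj_comp finj jinj.
  by have [v <-] := injective_self_map_surjective hjinj fjinj w; exists (j v).
have RH_inj : injective (@predecessor_labels A H).
  move=> v w; have [v' <-] := fsurj v; have [w' <-] := fsurj w.
  by rewrite !fP => /glfc_rays_inj ->.
exists f; apply: (iso_of_adjacency (RH := @predecessor_labels A H) lrG lrH _ _ _ fP).
- exact: glfc_adjacency.
- apply: adjacency_predecessor_labels => // v; have [v' <-] := fsurj v.
  by rewrite fP; exact: glfc_rays_nonempty.
- exact: inj_surj_bijective.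
Qed.

End Irreducible.
End FinitelyManyPredecessorSets.

(** * Unions of shifts over disjoint alphabets *)

Section DisjointUnion.
Variables (A : finType).
Implicit Types (X : set (int -> A)) (P : set (nat -> A)).

(* [X1] consists of the points of [X] having at least one, or equivalently only,
   letters in [A1]: each of [X1] and [X2] is such a part of their union. *)
Definition alphabet_component (A1 : set A) X1 X :=
  [/\ X1 `<=` X, forall z, X1 z -> forall i, A1 (z i) &
      forall z i, X z -> A1 (z i) -> X1 z].

Definition meets_alphabet (A1 : set A) P := exists2 y, P y & A1 (y 0%N).

Section Component.
Variables (A1 : set A) (X1 X : set (int -> A)).
Hypotheses (HX : shift_space X) (HX1 : shift_space X1).
Hypothesis comp : alphabet_component A1 X1 X.

(** A point of [X1] ending in [x] shows that [x] has its letters in [A1], and one such letter puts a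
    point of [X] into [X1]. *)
Lemma component_P_infty x : P_infty X1 x !=set0 -> P_infty X1 x = P_infty X x.
Proof.
have [sub let1 in1] := comp; rewrite !P_inftyE => -[y0 /= /let1 lx].
apply/seteqP; split=> y /=; first exact: sub.
by move=> /(in1 _ 0); apply; exact: (lx 0).
Qed.

Lemma meets_alphabet_P_infty x :
  meets_alphabet A1 (P_infty X x) -> P_infty X1 x = P_infty X x.
Proof.
have [sub let1 in1] := comp; move=> [y]; rewrite {1}P_inftyE => Xyx A1y.
apply: component_P_infty; rewrite P_inftyE; exists y => /=.
exact: (in1 _ (Negz 0)).
Qed.

Lemma component_meets_alphabet x :
  P_infty X1 x !=set0 -> meets_alphabet A1 (P_infty X1 x).
Proof.
have [sub let1 in1] := comp; rewrite P_inftyE => -[y X1yx].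
by exists y => //; exact: (let1 _ X1yx (Negz 0)).
Qed.

Lemma krieger_component (Q : krieger_vertex X) :
  meets_alphabet A1 (sval Q) -> exists Q1 : krieger_vertex X1, sval Q1 = sval Q.
Proof.
have [x [_ ->]] := svalP Q => mQ.
rewrite -meets_alphabet_P_infty //; apply: krieger_vertex_of.
by rewrite meets_alphabet_P_infty //; case: mQ => y Py _; exists y.
Qed.

Lemma krieger_component_inv (Q1 : krieger_vertex X1) :
  meets_alphabet A1 (sval Q1) /\ exists Q : krieger_vertex X, sval Q = sval Q1.
Proof.
have ne := krieger_nonempty Q1; have [x [_ Qx]] := svalP Q1.
move: ne; rewrite Qx => ne; split; first exact: component_meets_alphabet.
rewrite component_P_infty //; apply: krieger_vertex_of.
by rewrite -component_P_infty.
Qed.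

(** Decompositions transfer both ways: a nonempty piece of [Q] contains a ray ending in a letter of
    [A1], so it is also a Krieger vertex of [X1]. *)
Lemma indecomposable_component (Q1 : krieger_vertex X1) (Q : krieger_vertex X) :
  sval Q1 = sval Q -> indecomposable Q1 <-> indecomposable Q.
Proof.
move=> Q1Q; split=> indQ V QV.
  pose V1 := [set R1 : krieger_vertex X1 | exists2 R, V R & sval R1 = sval R].
  have [R VR] : V1 Q1.
    apply: indQ; rewrite Q1Q QV; apply/seteqP; split=> y; last first.
      by move=> [R1 [R VR R1R] R1y]; exists R => //; rewrite -R1R.
    move=> [R VR Ry]; have [|R1 R1R] := @krieger_component R.
      exists y => //; have : sval Q1 y by rewrite Q1Q QV; exists R.
      have [x [_ ->]] := svalP Q1; rewrite P_inftyE => X1yx.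
      by have [_ let1 _] := comp; exact: (let1 _ X1yx (Negz 0)).
    by exists R1; [exists R | rewrite R1R].
  by rewrite Q1Q => /sval_inj ->.
pose V' := [set R : krieger_vertex X | exists2 R1, V R1 & sval R1 = sval R].
have [R1 VR1] : V' Q.
  apply: indQ; rewrite -Q1Q QV; apply/seteqP; split=> y; last first.
    by move=> [R [R1 VR1 R1R] Ry]; exists R1 => //; rewrite R1R.
  move=> [R1 VR1 R1y]; have [_ [R RR1]] := krieger_component_inv R1.
  by exists R; [exists R1 | rewrite RR1].
by rewrite -Q1Q => /sval_inj <-.
Qed.

Lemma fischer_set_component P : fischer_set X1 P -> fischer_set X P.
Proof.
elim=> [Q1 indQ1|a {}P ne _]; last exact: fischer_residual.
have [_ [Q QQ1]] := krieger_component_inv Q1; rewrite -QQ1.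
apply: fischer_indecomposable.
exact/(indecomposable_component (esym QQ1)).
Qed.

Lemma fischer_set_component_inv P :
  fischer_set X P -> meets_alphabet A1 P -> fischer_set X1 P.
Proof.
elim=> [Q indQ mQ|a {}P ne fP IH [y Pay A1y]].
  have [Q1 Q1Q] := krieger_component mQ; rewrite -Q1Q.
  apply: fischer_indecomposable.
  exact/(indecomposable_component Q1Q).
apply: fischer_residual => //; apply: IH; exists (ray_cons a y) => //=.
have [x [Px _]] := fischer_set_krieger HX fP.
move: Pay; rewrite /residual /= Px P_inftyE => Xyx.
have [_ let1 in1] := comp.
(* [Negz 1] is the position of [y 0] in this point, and [Negz 0] that of [a]. *)
exact: (let1 _ (in1 _ (Negz 1) Xyx A1y) (Negz 0)).
Qed.

Lemma fischer_set_meets_alphabet P : fischer_set X1 P ->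
  meets_alphabet A1 P /\ forall y n, P y -> A1 (y n).
Proof.
move=> /(fischer_set_krieger HX1)[x [-> ne]]; split.
  exact: component_meets_alphabet.
have [_ let1 _] := comp.
by move=> y n; rewrite P_inftyE => X1yx; exact: (let1 _ X1yx (Negz n)).
Qed.

End Component.

Lemma disjoint_union_left_resolving (G H : lgraph A) :
  left_resolving G -> left_resolving H -> left_resolving (disjoint_union G H).
Proof.
move=> lrG lrH [e|e] [f|f] //= -[ef] lef; congr (_ _).
- exact: lrG.
- exact: lrH.
Qed.

Lemma glfc_disjoint_union (A1 A2 : set A) (X1 X2 : set (int -> A)) :
  A1 `&` A2 = set0 ->
  shift_space X1 -> (forall z, X1 z -> forall i, A1 (z i)) ->
  shift_space X2 -> (forall z, X2 z -> forall i, A2 (z i)) ->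
  let U := disjoint_union (generalised_left_fischer_cover X1)
                          (generalised_left_fischer_cover X2) in
  let G := generalised_left_fischer_cover (X1 `|` X2) in
  exists (f : vert U -> vert G) (g : edge U -> edge G),
    [/\ is_isomorphism f g,
        forall v1, glfc_rays (f (inl v1)) = glfc_rays v1
      & forall v2, glfc_rays (f (inr v2)) = glfc_rays v2].
Proof.
move=> A12 HX1 let1 HX2 let2 U G; set X := X1 `|` X2.
have A12F a : A1 a -> A2 a -> False.
  by move=> a1 a2; have : (A1 `&` A2) a by []; rewrite A12.
have HX : shift_space X.
  split; first exact: closedU HX1.1 HX2.1.
  by move=> z; rewrite /X /setU /= HX1.2 HX2.2.
have comp1 : alphabet_component A1 X1 X.
  split=> // [z|z i [//|/let2 z2 z1]]; first by left.
  by case: (A12F (z i)).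
have comp2 : alphabet_component A2 X2 X.
  split=> // [z|z i [/let1 z1 z2|//]]; first by right.
  by case: (A12F (z i)).
pose RU (v : vert U) :=
  match v with inl v1 => glfc_rays v1 | inr v2 => glfc_rays v2 end.
have /choice[f fP] : forall v, exists w : vert G, glfc_rays w = RU v.
  move=> [v|v]; apply: glfc_vertex_of => //.
    by apply: (fischer_set_component comp1); exact: glfc_rays_fischer.
  by apply: (fischer_set_component comp2); exact: glfc_rays_fischer.
have RU1 v1 := fischer_set_meets_alphabet HX1 comp1 (glfc_rays_fischer HX1 v1).
have RU2 v2 := fischer_set_meets_alphabet HX2 comp2 (glfc_rays_fischer HX2 v2).
have RU12 (v1 : vert (generalised_left_fischer_cover X1))
    (v2 : vert (generalised_left_fischer_cover X2)) : glfc_rays v1 = glfc_rays v2 -> False.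
  have [[y v1y A1y] _] := RU1 v1 => v12.
  by apply: A12F A1y _; apply: (RU2 v2).2; rewrite -v12.
have f_inj : injective f.
  move=> v w /(congr1 (@glfc_rays A X)); rewrite !fP.
  case: v w => [v|v] [w|w] /=.
  - by move=> /glfc_rays_inj ->.
  - by move=> /RU12.
  - by move=> /esym/RU12.
  - by move=> /glfc_rays_inj ->.
have f_surj w : exists v, f v = w.
  suff [v vw] : exists v, RU v = glfc_rays w.
    by exists v; apply: glfc_rays_inj; rewrite fP.
  have fw := glfc_rays_fischer HX w.
  have [x [wx [y wy]]] := fischer_set_krieger HX fw.
  (* Whether this point lies in [X1] or in [X2] decides the side of [w]. *)
  have : X (ray_cat y x) by move: wy; rewrite wx P_inftyE.
  case=> [/let1/(_ (Negz 0)) A1y|/let2/(_ (Negz 0)) A2y].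
    have /(glfc_vertex_of HX1)[v vw] : fischer_set X1 (glfc_rays w).
      by apply: (fischer_set_component_inv HX comp1 fw); exists y.
    by exists (inl v).
  have /(glfc_vertex_of HX2)[v vw] : fischer_set X2 (glfc_rays w).
    by apply: (fischer_set_component_inv HX comp2 fw); exists y.
  by exists (inr v).
have adjU (v : vert U) a (w : vert U) :
    (exists e : edge U, [/\ src e = v, lab e = a & rng e = w]) <->
    RU v = residual a (RU w).
  split=> [[[e|e] [<- <- <-]]|].
  - by apply/(glfc_adjacency HX1); exists e.
  - by apply/(glfc_adjacency HX2); exists e.
  case: v w => [v|v] [w|w] /=.
  - by move=> /(glfc_adjacency HX1)[e [<- <- <-]]; exists (inl e).
  (* Index 1 of [ray_cons a y] is [y 0], a letter of [A1], while rays in [w] have all their letters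
     in [A2]. *)
  - move=> vw; have [[y vy A1y] _] := RU1 v.
    rewrite vw in vy; case: (A12F _ A1y); exact: ((RU2 w).2 (ray_cons a y) 1%N vy).
  - move=> vw; have [[y vy A2y] _] := RU2 v.
    rewrite vw in vy; case: (A12F (y 0%N)) => //.
    exact: ((RU1 w).2 (ray_cons a y) 1%N vy).
  - by move=> /(glfc_adjacency HX2)[e [<- <- <-]]; exists (inr e).
have lrU : left_resolving U.
  by apply: disjoint_union_left_resolving; exact: glfc_left_resolving.
have [g fg] := iso_of_adjacency lrU (glfc_left_resolving HX) adjU
  (glfc_adjacency HX) (inj_surj_bijective f_inj f_surj) fP.
by exists f, g; split=> // v; rewrite fP.
Qed.

End DisjointUnion.

(** * The three assertions for sofic shifts *)

Theorem proposition3p4 (A : finType) :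
  (forall X : set (int -> A), sofic X ->
     [/\ presents (generalised_left_fischer_cover X) X,
         left_resolving (generalised_left_fischer_cover X)
       & predecessor_separated X (generalised_left_fischer_cover X)]) /\
  (forall X : set (int -> A), sofic X -> irreducible_shift X ->
     (exists F : lgraph A, is_left_fischer_cover X F) /\
     (forall F : lgraph A, is_left_fischer_cover X F ->
        isomorphic (generalised_left_fischer_cover X) F)) /\
  (forall (A1 A2 : set A) (X1 X2 : set (int -> A)),
     A1 `&` A2 = set0 ->
     sofic X1 -> (forall z, X1 z -> forall i, A1 (z i)) ->
     sofic X2 -> (forall z, X2 z -> forall i, A2 (z i)) ->
     exists
       (f : vert (disjoint_union (generalised_left_fischer_cover X1)
                                 (generalised_left_fischer_cover X2)) ->
            vert (generalised_left_fischer_cover (X1 `|` X2)))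
       (g : edge (disjoint_union (generalised_left_fischer_cover X1)
                                 (generalised_left_fischer_cover X2)) ->
            edge (generalised_left_fischer_cover (X1 `|` X2))),
       [/\ is_isomorphism f g,
           forall v1, glfc_rays (f (inl v1)) = glfc_rays v1
         & forall v2, glfc_rays (f (inr v2)) = glfc_rays v2]).
Proof.
have finX (X : set (int -> A)) : sofic X -> exists (I : finType)
    (F : I -> set (nat -> A)), forall x, exists i, P_infty X x = F i.
  by move=> [_ [G [finG GX]]]; exact: finite_P_infty finG.
split=> [X sofX|].
  have [I [F finP]] := finX X sofX; case: sofX => HX _; split.
  - exact: glfc_presents HX _ _ finP.
  - exact: glfc_left_resolving HX.
  - exact: glfc_predecessor_separated HX.
split=> [X sofX irrX|A1 A2 X1 X2 A12 [HX1 _] let1 [HX2 _] let2].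
  have [I [F finP]] := finX X sofX; case: sofX => HX _; split.
    exists (generalised_left_fischer_cover X).
    exact: glfc_is_left_fischer_cover HX _ _ finP irrX.
  by move=> H; exact: (left_fischer_cover_unique HX finP irrX).
exact: (glfc_disjoint_union A12 HX1 let1 HX2 let2).
Qed.
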